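(* Let $L\ge\alpha>0$, let $f:\mathbb{R}^d\to\mathbb{R}$ be $(\alpha,L)$-nearly convex, and let $x^*$ be a global minimizer of $f$ with $f(x^* )=f^*$. Then the following statements hold. (a) For any function $\bar f\in\mathcal{P}_\alpha(x^*,f^* )$ one has $$\bar f(x)-f^*\ge\frac{\alpha}{2}\|x-x^*\|^2\qquad\forall x\in\mathbb{R}^d.$$ (b) One has $\beta:=\beta(f,x^*,\alpha)<\alpha$ and $$\frac{\alpha-\beta}{2}\|x-x^*\|^2\le f(x)-f(x^* )\le\frac L2\|x-x^*\|^2\qquad\forall x\in\mathbb{R}^d.$$ Moreover, $x^*$ is the unique global minimizer of $f$.
   Context: Norms are Euclidean. For $\alpha>0$, $\bar x\in\mathbb{R}^d$, $c\in\mathbb{R}$, the set of one-point strongly convex functions is $$\mathcal{P}_\alpha(\bar x,c)=\{\bar f\in C^1(\mathbb{R}^d)\mid \bar f(\bar x)=c,\ \langle\nabla\bar f(x),x-\bar x\rangle\ge\alpha\|x-\bar x\|^2\ \ \forall x\in\mathbb{R}^d\}.$$ For $f\in C^1(\mathbb{R}^d)$, $$\beta(f,\bar x,\alpha):=\inf_{\bar f\in\mathcal{P}_\alpha(\bar x,f(\bar x))}\ \sup_{x\ne\bar x}\frac{2|f(x)-\bar f(x)|}{\|x-\bar x\|^2}.$$ For $L\ge\alpha>0$, a continuously differentiable $f:\mathbb{R}^d\to\mathbb{R}$ is $(\alpha,L)$-nearly convex if (i) $f$ has a unique global minimizer $x^*$; (ii) $\|\nabla f(x)\|\le L\|x-x^*\|$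 for all $x\in\mathbb{R}^d$; (iii) $\beta(f,x^*,\alpha)\le\frac14\sqrt{\frac{\alpha^5}{dL^3}}$. *)

(* Defs.v *)
From HB Require Import structures.
From mathcomp Require Import all_boot all_order all_algebra.
From mathcomp Require Import boolp classical_sets functions reals ereal.
From mathcomp Require Import topology normedtype derive.
Set Implicit Arguments.
Unset Strict Implicit.
Unset Printing Implicit Defensive.
Import Order.TTheory GRing.Theory Num.Theory.
Import numFieldNormedType.Exports.
Local Open Scope ring_scope.
Local Open Scope classical_set_scope.

Definition dotp (R : realType) (d : nat) (u v : 'rV[R]_d) : R :=
  \sum_(i < d) u 0 i * v 0 i.

(* The library norm `|x| on 'rV[R]_d is the sup norm; it induces the same
   topology, hence the same notions of continuity and differentiability, as
   the Euclidean norm below. *)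
Definition enorm (R : realType) (d : nat) (x : 'rV[R]_d) : R :=
  Num.sqrt (dotp x x).

Definition gradient (R : realType) (d : nat) (f : 'rV[R]_d -> R)
    (x : 'rV[R]_d) : 'rV[R]_d :=
  \row_(i < d) 'D_(delta_mx 0 i) f x.

Definition C1 (R : realType) (d : nat) (f : 'rV[R]_d -> R) : Prop :=
  (forall x, differentiable f x) /\ continuous (gradient f).

Definition one_point_strongly_convex (R : realType) (d : nat) (alpha : R)
    (xbar : 'rV[R]_d) (c : R) : set ('rV[R]_d -> R) :=
  [set g | [/\ C1 g, g xbar = c &
    forall x : 'rV[R]_d,
      alpha * enorm (x - xbar) ^+ 2 <= dotp (gradient g x) (x - xbar)]].

(* The infimum and supremum are taken in the extended reals, since the
   supremum may be infinite for every competitor g. *)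
Definition beta (R : realType) (d : nat) (f : 'rV[R]_d -> R)
    (xbar : 'rV[R]_d) (alpha : R) : \bar R :=
  ereal_inf
    [set ereal_sup [set (2 * `|f x - g x| / enorm (x - xbar) ^+ 2)%:E
                   | x in [set x | x <> xbar]]
    | g in one_point_strongly_convex alpha xbar (f xbar)].

Definition global_minimizer (R : realType) (d : nat) (f : 'rV[R]_d -> R)
    (x : 'rV[R]_d) : Prop :=
  forall y, f x <= f y.

Definition nearly_convex (R : realType) (d : nat) (alpha L : R)
    (f : 'rV[R]_d -> R) : Prop :=
  C1 f /\
  exists xs : 'rV[R]_d,
    [/\ unique (global_minimizer f) xs,
        forall x : 'rV[R]_d, enorm (gradient f x) <= L * enorm (x - xs) &
        (beta f xs alpha
           <= (4^-1 * Num.sqrt (alpha ^+ 5 / (d%:R * L ^+ 3)))%:E)%E].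

(* Main.v *)
Require Import Defs.
From HB Require Import structures.
From mathcomp Require Import all_boot all_order all_algebra.
From mathcomp Require Import boolp classical_sets functions reals ereal.
From mathcomp Require Import topology normedtype derive.
From mathcomp Require Import lra.
Import Order.TTheory GRing.Theory Num.Theory.
Import numFieldNormedType.Exports.
Local Open Scope ring_scope.
Local Open Scope classical_set_scope.

(** Both quadratic estimates come from integrating a radial derivative bound:
    if [c |y - x0|^2 <= 'D_(y - x0) h y] for all [y], then along the ray
    [t |-> x0 + t (x - x0)] the function [h] has slope at least
    [c t |x - x0|^2], so that [h x - h x0 >= c / 2 |x - x0|^2]
    ([quadratic_lower_bound]).  For a member of [P_alpha] the derivative bound
    is the defining inequality, which gives their quadratic growth.  For [- f] it holds with
    [c = - L], since [|grad f y| <= L |y - xs|] forces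
    [<grad f y, y - xs> <= L |y - xs|^2]; this gives the upper estimate for [f].

    For the lower estimate, any competitor [g] satisfies
    [f x - f xs >= (g x - f xs) - |f x - g x|], and the quadratic growth of
    [g] bounds the first term below.  Dividing by [|x - xs|^2 / 2], the number
    [alpha - 2 (f x - f xs) / |x - xs|^2] is at most the supremum attached to
    [g], for every [g]; hence it is at most [beta] ([beta_lower_bound]).  No
    competitor has to attain the infimum.  Finally [beta] lies between [0] and
    [alpha / 4], because [alpha^5 / (d L^3) <= alpha^2], so it is a real number
    smaller than [alpha]. *)

(** * Euclidean geometry of row vectors *)

Lemma dotp_ge0 {R : realType} {d : nat} (u : 'rV[R]_d) : 0 <= dotp u u.
Proof. by apply: sumr_ge0 => i _; rewrite -expr2 sqr_ge0. Qed.

Lemma sqr_enorm {R : realType} {d : nat} (u : 'rV[R]_d) :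
  enorm u ^+ 2 = dotp u u.
Proof. by rewrite /enorm sqr_sqrtr // dotp_ge0. Qed.

Lemma enorm_ge0 {R : realType} {d : nat} (u : 'rV[R]_d) : 0 <= enorm u.
Proof. exact: sqrtr_ge0. Qed.

Lemma sqr_enormZ {R : realType} {d : nat} (a : R) (u : 'rV[R]_d) :
  enorm (a *: u) ^+ 2 = a ^+ 2 * enorm u ^+ 2.
Proof.
rewrite !sqr_enorm /dotp mulr_sumr; apply: eq_bigr => i _.
by rewrite !mxE mulrACA expr2.
Qed.

Lemma sqr_enorm_gt0 {R : realType} {d : nat} (u : 'rV[R]_d) :
  u <> 0 -> 0 < enorm u ^+ 2.
Proof.
move=> u0; rewrite sqr_enorm lt_def dotp_ge0 andbT.
apply/eqP => uu0; apply: u0; apply/rowP => i; rewrite mxE.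
have /(_ i isT)/eqP : forall i : 'I_d, true -> u 0 i * u 0 i = 0.
  apply: psumr_eq0P uu0 => j _.
  by rewrite -expr2 sqr_ge0.
by rewrite mulf_eq0 orbb => /eqP.
Qed.

(** Expanding [0 <= |u - L v|^2] bounds [2 L <u, v>] by [|u|^2 + L^2 |v|^2],
    and the hypothesis makes this at most [2 L^2 |v|^2]. *)
Lemma dotp_le_of_enorm {R : realType} {d : nat} (L : R) (u v : 'rV[R]_d) :
  0 < L -> enorm u <= L * enorm v -> dotp u v <= L * enorm v ^+ 2.
Proof.
move=> L0 uv.
have exp : dotp (u - L *: v) (u - L *: v)
    = dotp u u - 2 * L * dotp u v + L ^+ 2 * dotp v v.
  rewrite /dotp !mulr_sumr -sumrB -big_split /=; apply: eq_bigr => i _.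
  by rewrite !mxE; lra.
have sq : enorm u ^+ 2 <= L ^+ 2 * enorm v ^+ 2.
  by rewrite -exprMn ler_sqr // nnegrE ?mulr_ge0 ?enorm_ge0 // ltW.
have := dotp_ge0 (u - L *: v); rewrite exp -!sqr_enorm => ge0.
rewrite -(ler_pM2l L0); nra.
Qed.

(** * Growth along rays *)

Lemma derive_dotp_gradient {R : realType} {d : nat} (f : 'rV[R]_d -> R)
    (x v : 'rV[R]_d) :
  differentiable f x -> 'D_v f x = dotp (gradient f x) v.
Proof.
move=> df; rewrite deriveE // [v in LHS]row_sum_delta linear_sum /=.
apply: eq_bigr => i _.
by rewrite linearZ /= mxE deriveE // mulrC.
Qed.

(** The difference quotients of [h] restricted to a line are those of [h]. *)
Lemma is_derive_line {R : realType} {V : normedModType R} (h : V -> R)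
    (x0 v : V) (t dh : R) :
  is_derive (x0 + t *: v) v h dh ->
  is_derive t 1 (fun s => h (x0 + s *: v)) dh.
Proof.
move=> [dvh hE].
have quotE : (fun s : R => s^-1 *:
      (((fun r : R => h (x0 + r *: v)) \o shift t) (s *: (1 : R^o))
       - h (x0 + t *: v)))
    = (fun s : R => s^-1 *: ((h \o shift (x0 + t *: v)) (s *: v)
       - h (x0 + t *: v))).
  apply/funext => s /=.
  by rewrite [s *: 1]mulr1 scalerDl addrCA.
by split; [rewrite /derivable quotE | rewrite /derive quotE].
Qed.

(** Subtracting [c / 2 t^2] from [h] on the ray leaves a function with
    nonnegative derivative.  The slope is controlled for [t > 0] only, which is
    all that the mean value theorem on the open interval sees, and all that
    homogeneity of the differential can supply. *)
Lemma radial_growth {R : realType} {V : normedModType R} (h : V -> R)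
    (x0 v : V) (c : R) :
  (forall y, differentiable h y) ->
  (forall t : R, 0 < t -> c * t <= 'D_v h (x0 + t *: v)) ->
  c / 2 <= h (x0 + v) - h x0.
Proof.
move=> dh slope.
pose psi (t : R) : R := h (x0 + t *: v) - c / 2 * t ^+ 2.
have dpsi (t : R) : is_derive t 1 psi ('D_v h (x0 + t *: v) - c * t).
  have dline : is_derive t 1 (fun s => h (x0 + s *: v)) ('D_v h (x0 + t *: v)).
    by apply: is_derive_line; apply: DeriveDef => //; exact: diff_derivable.
  have dsq : is_derive t 1 (fun s : R => c / 2 * s ^+ 2) (c * t).
    apply: is_derive_eq.
    by rewrite /GRing.scale /=; lra.
  exact: is_deriveB.
have cpsi : {within `[0, 1], continuous psi}.
  apply: continuous_subspaceT => t.
  by apply/differentiable_continuous/derivable1_diffP; case: (dpsi t).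
have [t] := MVT ltr01 (fun t _ => dpsi t) cpsi.
rewrite in_itv /= => /andP[t0 _].
rewrite /psi scale1r scale0r addr0 expr1n expr0n /=.
have := slope t t0; lra.
Qed.

Lemma quadratic_lower_bound {R : realType} {d : nat} (h : 'rV[R]_d -> R)
    (x0 : 'rV[R]_d) (c : R) :
  (forall y, differentiable h y) ->
  (forall y, c * enorm (y - x0) ^+ 2 <= 'D_(y - x0) h y) ->
  forall x, c / 2 * enorm (x - x0) ^+ 2 <= h x - h x0.
Proof.
move=> dh slope x.
have := @radial_growth _ _ h x0 (x - x0) (c * enorm (x - x0) ^+ 2) dh.
rewrite [x0 + _]addrC subrK mulrAC; apply => t t0.
have := slope (x0 + t *: (x - x0)).
rewrite addrAC subrr add0r sqr_enormZ !deriveE // linearZ /=.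
(* homogeneity of the differential in the direction lets a factor t cancel *)
move=> radial; rewrite -(ler_pM2l t0); apply: le_trans radial; lra.
Qed.

(** * The distance to one-point strongly convex functions *)

Lemma one_point_strongly_convex_growth {R : realType} {d : nat} {alpha c : R}
    {x0 : 'rV[R]_d} {g : 'rV[R]_d -> R} :
  one_point_strongly_convex alpha x0 c g ->
  forall x, alpha / 2 * enorm (x - x0) ^+ 2 <= g x - c.
Proof.
move=> [[dg _] <- slope] x; apply: quadratic_lower_bound => // y.
by rewrite derive_dotp_gradient.
Qed.

Lemma quadratic_upper_bound {R : realType} {d : nat} (f : 'rV[R]_d -> R)
    (x0 : 'rV[R]_d) (L : R) :
  0 < L -> (forall y, differentiable f y) ->
  (forall y, enorm (gradient f y) <= L * enorm (y - x0)) ->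
  forall x, f x - f x0 <= L / 2 * enorm (x - x0) ^+ 2.
Proof.
move=> L0 df lip x.
have := @quadratic_lower_bound _ _ (- f) x0 (- L).
move=> /(_ (fun y => differentiableN (df y))).
have slope y : - L * enorm (y - x0) ^+ 2 <= 'D_(y - x0) (- f) y.
  rewrite deriveN; last exact: diff_derivable.
  by rewrite derive_dotp_gradient // mulNr lerN2 dotp_le_of_enorm.
move=> /(_ slope x); rewrite /= !fctE; lra.
Qed.

(** For each competitor [g], the given point [x] alone already makes the
    supremum large enough: [|f x - g x|] is at least [g x - f x], and [g] grows
    quadratically. *)
Lemma beta_lower_bound {R : realType} {d : nat} (f : 'rV[R]_d -> R)
    (x0 x : 'rV[R]_d) (alpha : R) :
  x <> x0 ->
  ((alpha - 2 * (f x - f x0) / enorm (x - x0) ^+ 2)%:E <= beta f x0 alpha)%E.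
Proof.
move=> xx0; apply: le_ereal_inf_tmp => _ [g gP <-].
apply: le_ereal_sup_tmp; eexists; first by exists x.
have n0 : 0 < enorm (x - x0) ^+ 2.
  by apply: sqr_enorm_gt0 => /eqP; rewrite subr_eq0 => /eqP.
rewrite lee_fin lerBlDr -mulrDl ler_pdivlMr //.
have := one_point_strongly_convex_growth gP x.
have := ler_norm (g x - f x); rewrite distrC; lra.
Qed.

(** The positivity of [d] provides a point other than [x0]; in dimension zero
    every supremum in the definition would be [-oo]. *)
Lemma beta_ge0 {R : realType} {d : nat} (f : 'rV[R]_d -> R)
    (x0 : 'rV[R]_d) (alpha : R) :
  (0 < d)%N -> (0 <= beta f x0 alpha)%E.
Proof.
move=> d0; apply: le_ereal_inf_tmp => _ [g _ <-].
apply: le_ereal_sup_tmp; eexists; first exists (x0 + const_mx 1).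
- move=> /= /eqP; rewrite addrC -subr_eq0 addrK => /eqP /rowP /(_ (Ordinal d0)).
  by rewrite !mxE => /eqP; rewrite oner_eq0.
- by [].
- by rewrite lee_fin divr_ge0 ?sqr_ge0 ?mulr_ge0.
Qed.

Lemma nearly_convex_constant_lt {R : realType} (d : nat) (alpha L : R) :
  (0 < d)%N -> 0 < alpha -> alpha <= L ->
  4^-1 * Num.sqrt (alpha ^+ 5 / (d%:R * L ^+ 3)) < alpha.
Proof.
move=> d0 a0 aL.
have L0 : 0 < L by exact: lt_le_trans aL.
have d1 : 1 <= d%:R :> R by rewrite ler1n.
suff : Num.sqrt (alpha ^+ 5 / (d%:R * L ^+ 3)) <= alpha by lra.
rewrite -[leRHS]gtr0_norm // -sqrtr_sqr; apply: ler_wsqrtr.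
rewrite ler_pdivrMr; last by rewrite mulr_gt0 ?exprn_gt0 // (lt_le_trans ltr01).
rewrite (exprD alpha 2 3) ler_pM2l ?exprn_gt0 //.
rewrite -[leLHS]mul1r; apply: ler_pM => //; first exact/exprn_ge0/ltW.
by rewrite lerXn2r // nnegrE ltW.
Qed.

Theorem proposition3p1 (R : realType) (d : nat) (alpha L : R)
    (f : 'rV[R]_d -> R) (xs : 'rV[R]_d) (fs : R) :
  (0 < d)%N -> 0 < alpha -> alpha <= L ->
  nearly_convex alpha L f ->
  global_minimizer f xs -> f xs = fs ->
  (forall fbar : 'rV[R]_d -> R, one_point_strongly_convex alpha xs fs fbar ->
     forall x : 'rV[R]_d, alpha / 2 * enorm (x - xs) ^+ 2 <= fbar x - fs)
  /\
  ((exists b : R,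
      [/\ beta f xs alpha = b%:E,
          b < alpha &
          forall x : 'rV[R]_d, (alpha - b) / 2 * enorm (x - xs) ^+ 2 <= f x - f xs
                    /\ f x - f xs <= L / 2 * enorm (x - xs) ^+ 2])
   /\ unique (global_minimizer f) xs).
Proof.
move=> d0 a0 aL [[df _] [z [[minz uniqz] lip beta_le]]] minxs fxs.
have zxs : z = xs by exact: uniqz.
subst z; split; first by move=> g; exact: one_point_strongly_convex_growth.
split; last by split.
have b0 := beta_ge0 f xs alpha d0.
have bfin : beta f xs alpha \is a fin_num.
  by rewrite fin_numE; case: (beta f xs alpha) b0 beta_le.
have bE := fineK bfin.
exists (fine (beta f xs alpha)); split => [//||x].
  rewrite -lte_fin bE; apply: le_lt_trans beta_le _.
  by rewrite lte_fin nearly_convex_constant_lt.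
split; last by apply: quadratic_upper_bound => //; exact: lt_le_trans aL.
have [->|/eqP xxs] := eqVneq x xs.
  by rewrite !subrr sqr_enorm /dotp big1 ?mulr0 // => i _; rewrite mxE mul0r.
have n0 : 0 < enorm (x - xs) ^+ 2.
  by apply: sqr_enorm_gt0 => /eqP; rewrite subr_eq0 => /eqP.
have := beta_lower_bound f xs x alpha xxs.
rewrite -bE lee_fin lerBlDl -lerBlDr ler_pdivlMr //; lra.
Qed.
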